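(* Let $q$ be a prime power and let $L$ be a line of $\mathrm{PG}(5,q)$ in the $K$-orbit $o_6$. Then the hyperplane-orbit distribution of $L$ is $OD_4(L)=\left[q+1,\,\frac{3q^2+q}{2},\,\frac{q^2-q}{2},\,q^3-q^2\right]$.
   Context: A point $(y_0,\dots,y_5)$ of $\mathrm{PG}(5,q)$ is identified with the nonzero symmetric matrix $\begin{bmatrix} y_0&y_1&y_2\\ y_1&y_3&y_4\\ y_2&y_4&y_5\end{bmatrix}$ up to scalar. $K\cong\mathrm{PGL}(3,q)$ acts by $M\mapsto AMA^T$, $A\in\mathrm{GL}(3,q)$. The orbit $o_6$ is the $K$-orbit of the line $\left\{\begin{bmatrix} x&y&0\\ y&0&0\\ 0&0&0\end{bmatrix}:(x,y)\in\mathrm{PG}(1,q)\right\}$. Hyperplanes correspond to conics of $\mathrm{PG}(2,q)$ (nonzero quadratic forms up to scalar): $\sum_{0\le i\le j\le2}a_{ij}X_iX_j$ corresponds to $a_{00}Y_0+a_{01}Y_1+a_{02}Y_2+a_{11}Y_3+a_{12}Y_4+a_{22}Y_5=0$. $\mathcal H_1,\mathcal H_{2,r},\mathcal H_{2,i},\mathcal H_3$ are the sets of hyperplanes corresponding respectively to double lines (scalar multiples of squares of linear forms), pairs of distinct real lines (products of two non-proportional linear forms over $\mathbb F_q$), pairs of conjugate imaginary lines (scalar multiples of products of two non-proportional linear forms conjugate over $\mathbb F_{q^2}$), and non-singular conics (those with $4a_{00}a_{11}a_{22}+a_{01}a_{02}a_{12}-a_{00}a_{12}^2-a_{11}a_{02}^2-a_{22}a_{01}^2\ne0$).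 $OD_4(L)=[h_1,h_{2,r},h_{2,i},h_3]$ lists the numbers of hyperplanes in $\mathcal H_1,\mathcal H_{2,r},\mathcal H_{2,i},\mathcal H_3$ containing $L$. *)

(* Defs.v *)
From HB Require Import structures.
From mathcomp Require Import all_boot all_order all_fingroup all_algebra.
From mathcomp Require Import mpoly.

Set Implicit Arguments.
Unset Strict Implicit.
Unset Printing Implicit Defensive.

Import GRing.Theory.
Local Open Scope ring_scope.

(* Position, in the sequence 00, 01, 02, 11, 12, 22, of the unordered pair
   {i, j}.  Points (y_0, ..., y_5) of PG(5,q) and coefficient vectors
   (a_00, a_01, a_02, a_11, a_12, a_22) of conics share this indexing. *)
Definition sidx (i j : 'I_3) : 'I_6 :=
  inord (nth 0%N (nth [::] [:: [:: 0; 1; 2]; [:: 1; 3; 4]; [:: 2; 4; 5]]%N i) j).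

Section ProjectiveSpace.
Variable F : finFieldType.

(* Subspaces of PG(5,q) are represented by the corresponding sets of coordinate
   vectors in 'rV[F]_6 (zero vector included). *)

Definition symm (y : 'rV[F]_6) : 'M[F]_3 := \matrix_(i, j) y 0 (sidx i j).

Definition o6_mx (x y : F) : 'M[F]_3 :=
  \matrix_(i, j)
    nth 0 (nth [::] [:: [:: x; y; 0]; [:: y; 0; 0]; [:: 0; 0; 0]] i) j.

Definition o6_rep : {set 'M[F]_3} := [set o6_mx xy.1 xy.2 | xy : F * F].

Definition in_o6 (L : {vspace 'rV[F]_6}) : Prop :=
  exists2 A : 'M[F]_3, A \in unitmx &
    [set symm y | y in L] = [set A *m M *m A^T | M in o6_rep].

Definition hyperplane (a : 'rV[F]_6) : {set 'rV[F]_6} :=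
  [set y : 'rV[F]_6 | \sum_(k < 6) a 0 k * y 0 k == 0].

End ProjectiveSpace.

Definition lform (R : finFieldType) (l : 'rV[R]_3) : {mpoly R[3]} :=
  \sum_(i < 3) l 0 i *: 'X_i.

Definition qform (R : finFieldType) (a : 'rV[R]_6) : {mpoly R[3]} :=
  \sum_(i < 3) \sum_(j < 3 | (i <= j)%N) a 0 (sidx i j) *: ('X_i * 'X_j).

Definition proportional (R : finFieldType) (l m : 'rV[R]_3) : bool :=
  [exists c : R, (l == c *: m) || (m == c *: l)].

Section Conics.
(* iota embeds F = F_q in E, which is meant to have q^2 elements. *)
Variables (F E : finFieldType) (iota : {rmorphism F -> E}).
Implicit Types (a : 'rV[F]_6) (L : {vspace 'rV[F]_6}).

(* The nontrivial automorphism of F_(q^2) over F_q is x |-> x ^ q. *)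
Definition conj_form (l : 'rV[E]_3) : 'rV[E]_3 :=
  map_mx (fun x => x ^+ #|F|) l.

Definition double_line a : bool :=
  [exists c : F, exists l : 'rV[F]_3, qform a == c *: lform l ^+ 2].

Definition real_line_pair a : bool :=
  [exists l : 'rV[F]_3, exists m : 'rV[F]_3,
    ~~ proportional l m && (qform a == lform l * lform m)].

Definition imaginary_line_pair a : bool :=
  [exists c : F, exists l : 'rV[E]_3,
    ~~ proportional l (conj_form l) &&
    (map_mpoly iota (qform a) == iota c *: (lform l * lform (conj_form l)))].

Definition conic_disc a : F :=
  let c (i j : nat) := a 0 (sidx (inord i) (inord j)) in
  4%:R * c 0 0 * c 1 1 * c 2 2 + c 0 1 * c 0 2 * c 1 2
  - c 0 0 * c 1 2 ^+ 2 - c 1 1 * c 0 2 ^+ 2 - c 2 2 * c 0 1 ^+ 2.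

Definition nonsingular a : bool := conic_disc a != 0.

Definition hyperplanes (P : pred 'rV[F]_6) : {set {set 'rV[F]_6}} :=
  [set hyperplane a | a in [pred a | (a != 0) && P a]].

Definition hyp1 := hyperplanes double_line.
Definition hyp2r := hyperplanes real_line_pair.
Definition hyp2i := hyperplanes imaginary_line_pair.
Definition hyp3 := hyperplanes nonsingular.

Definition OD4 L : seq nat :=
  [seq #|[set H in HH : {set {set 'rV[F]_6}} | L \subset H]|
     | HH <- [:: hyp1; hyp2r; hyp2i; hyp3]].

End Conics.

(* Main.v *)
(** The line L lies in the hyperplane of the conic f exactly when f, pulled back
by the matrix A carrying the representative line to L, has vanishing
coefficients at X_0^2 and X_0 X_1.  Each of the four types of conics is
invariant under invertible substitutions, so it suffices to sort the forms
c02 X_0 X_2 + c11 X_1^2 + c12 X_1 X_2 + c22 X_2^2 by type.  The discriminant is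
-c11 c02^2; if c11 = 0 the form is X_2 times a linear form; if c02 = 0 it is a
binary quadratic form in X_1, X_2, which is counted through its roots: ordered
pairs of distinct roots over F, or conjugate roots over E, are two to one over
the forms.  Dividing by the q - 1 scalars gives the numbers of hyperplanes. *)

Require Import Defs.
From mathcomp Require Import all_boot all_order all_fingroup all_algebra.
From mathcomp Require Import all_field abelian pgroup.
From mathcomp Require Import mpoly.
From mathcomp Require Import ring zify.

Import GRing.Theory.
Local Open Scope ring_scope.

(** * Coordinate vectors indexed by small ordinals *)

Lemma sum_ord3 (V : nmodType) (f : 'I_3 -> V) :
  \sum_(i < 3) f i = f (inord 0) + f (inord 1) + f (inord 2).
Proof.
rewrite !big_ord_recr big_ord0 /= add0r.
by congr (f _ + f _ + f _); apply: val_inj; rewrite /= inordK.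
Qed.

Lemma sum_ord6 (V : nmodType) (f : 'I_6 -> V) :
  \sum_(i < 6) f i = f (inord 0) + f (inord 1) + f (inord 2) + f (inord 3)
    + f (inord 4) + f (inord 5).
Proof.
rewrite !big_ord_recr big_ord0 /= add0r.
by congr (f _ + f _ + f _ + f _ + f _ + f _); apply: val_inj; rewrite /= inordK.
Qed.

Lemma sidx_inord (i j : nat) : (i < 3)%N -> (j < 3)%N ->
  sidx (inord i) (inord j) =
  inord (nth 0 (nth [::] [:: [:: 0; 1; 2]; [:: 1; 3; 4]; [:: 2; 4; 5]] i) j)%N.
Proof. by move=> i3 j3; rewrite /sidx !inordK. Qed.

(** The default of [nth] is [x0] so that the entries may have any type; an index below 6 never
    reaches it. *)
Definition row6 (R : Type) (x0 x1 x2 x3 x4 x5 : R) : 'rV[R]_6 :=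
  \row_k nth x0 [:: x0; x1; x2; x3; x4; x5] k.

Arguments row6 {R}.

Lemma row6E (R : Type) (x0 x1 x2 x3 x4 x5 : R) (k : nat) : (k < 6)%N ->
  row6 x0 x1 x2 x3 x4 x5 0 (inord k) = nth x0 [:: x0; x1; x2; x3; x4; x5] k.
Proof. by move=> k6; rewrite mxE inordK. Qed.

Lemma ord_inordP (n : nat) (P : 'I_n.+1 -> Prop) :
  (forall k, (k < n.+1)%N -> P (inord k)) -> forall i, P i.
Proof. by move=> Pk i; rewrite -[i]inord_val; apply: Pk. Qed.

Lemma row6_eta (R : Type) (a : 'rV[R]_6) :
  a = row6 (a 0 (inord 0)) (a 0 (inord 1)) (a 0 (inord 2))
           (a 0 (inord 3)) (a 0 (inord 4)) (a 0 (inord 5)).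
Proof.
apply/rowP; apply: ord_inordP => k k6; rewrite row6E //.
by case: k k6 => [|[|[|[|[|[|]]]]]].
Qed.

Lemma row6_inj (R : Type) (x0 x1 x2 x3 x4 x5 y0 y1 y2 y3 y4 y5 : R) :
  row6 x0 x1 x2 x3 x4 x5 = row6 y0 y1 y2 y3 y4 y5 ->
  [/\ x0 = y0, x1 = y1, x2 = y2 & [/\ x3 = y3, x4 = y4 & x5 = y5]].
Proof.
move=> e; have E k : (k < 6)%N -> nth x0 [:: x0; x1; x2; x3; x4; x5] k =
    nth y0 [:: y0; y1; y2; y3; y4; y5] k by move=> k6; rewrite -!row6E // e.
by split; [exact: (E 0) | exact: (E 1) | exact: (E 2) | split;
  [exact: (E 3) | exact: (E 4) | exact: (E 5)]].
Qed.

Arguments row6_inj {R x0 x1 x2 x3 x4 x5 y0 y1 y2 y3 y4 y5}.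

(** * Linear substitutions in ternary quadratic forms *)

Section Substitution.
Variable R : comNzRingType.
Implicit Types (a : 'rV[R]_6) (A N : 'M[R]_3) (l m : 'rV[R]_3).

(** Coefficients of [X^T N X]. The matrix [N] need not be symmetric, so that no division by 2 occurs
    and characteristic 2 is covered. *)
Definition mx_form N : 'rV[R]_6 :=
  let n (i j : nat) := N (inord i) (inord j) in
  row6 (n 0%N 0%N) (n 0%N 1%N + n 1%N 0%N) (n 0%N 2%N + n 2%N 0%N)
       (n 1%N 1%N) (n 1%N 2%N + n 2%N 1%N) (n 2%N 2%N).

Definition form_mx a : 'M[R]_3 :=
  \matrix_(i, j) if (i <= j)%N then a 0 (sidx i j) else 0.

(** The form after replacing the column [X] of variables by [A X]. *)
Definition subst A a : 'rV[R]_6 := mx_form (A^T *m form_mx a *m A).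

Definition prod_form l m : 'rV[R]_6 := mx_form (l^T *m m).

Lemma form_mxK : cancel form_mx mx_form.
Proof.
move=> a; rewrite [RHS]row6_eta /mx_form !mxE !inordK //= !sidx_inord //=.
by rewrite ?addr0.
Qed.

(** [form_mx (mx_form N)] differs from [N] by an alternating matrix, and congruence by [A] keeps it
    alternating. Hence any matrix of a form may be used to compute a substitution. *)
Lemma subst_mx_form A N : subst A (mx_form N) = mx_form (A^T *m N *m A).
Proof.
rewrite /subst {1 3}/mx_form.
by congr row6; rewrite !(mxE, sum_ord3) !inordK //=; ring.
Qed.

Lemma substM A B a : subst B (subst A a) = subst (A *m B) a.
Proof. by rewrite {2}/subst subst_mx_form /subst trmx_mul !mulmxA. Qed.

Lemma subst1 a : subst 1%:M a = a.
Proof. by rewrite /subst trmx1 mul1mx mulmx1 form_mxK. Qed.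

Lemma subst_prod_form A l m :
  subst A (prod_form l m) = prod_form (l *m A) (m *m A).
Proof. by rewrite subst_mx_form /prod_form trmx_mul !mulmxA. Qed.

Lemma mx_formZ c N : mx_form (c *: N) = c *: mx_form N.
Proof.
rewrite [RHS]row6_eta /mx_form.
by congr row6; rewrite !mxE inordK //= ?mulrDr.
Qed.

Lemma substZ A c a : subst A (c *: a) = c *: subst A a.
Proof.
rewrite -mx_formZ -[in c *: a](form_mxK a) -mx_formZ subst_mx_form.
by rewrite -scalemxAr -scalemxAl.
Qed.

Lemma prod_formE l m : let x (i : nat) := l 0 (inord i) in
    let y (i : nat) := m 0 (inord i) in
  prod_form l m = row6 (x 0%N * y 0%N) (x 0%N * y 1%N + x 1%N * y 0%N)
    (x 0%N * y 2%N + x 2%N * y 0%N) (x 1%N * y 1%N)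
    (x 1%N * y 2%N + x 2%N * y 1%N) (x 2%N * y 2%N).
Proof. by rewrite /prod_form /mx_form !(mxE, big_ord1). Qed.

Lemma prod_formZl c l m : prod_form (c *: l) m = c *: prod_form l m.
Proof. by rewrite /prod_form linearZ -scalemxAl mx_formZ. Qed.

End Substitution.

Lemma map_row6 (R S : Type) (f : R -> S) (x0 x1 x2 x3 x4 x5 : R) :
  map_mx f (row6 x0 x1 x2 x3 x4 x5) =
  row6 (f x0) (f x1) (f x2) (f x3) (f x4) (f x5).
Proof. by rewrite [LHS]row6_eta; congr row6; rewrite mxE row6E. Qed.

Lemma map_subst (R S : comNzRingType) (f : {rmorphism R -> S}) A a :
  map_mx f (subst R A a) = subst S (map_mx f A) (map_mx f a).
Proof.
have map_mx_form N : map_mx f (mx_form R N) = mx_form S (map_mx f N).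
  by rewrite /mx_form map_row6 !rmorphD ![map_mx f N _ _]mxE.
rewrite /subst map_mx_form !map_mxM map_trmx; congr (mx_form _ (_ *m _ *m _)).
by apply/matrixP => i j; rewrite !mxE; case: ifP; rewrite ?rmorph0.
Qed.

Arguments mx_form {R}.
Arguments form_mx {R}.
Arguments subst {R}.
Arguments prod_form {R}.

(** * Quadratic forms as polynomials *)

Section QuadraticForms.
Variable R : finFieldType.
Implicit Types (a b : 'rV[R]_6) (l m : 'rV[R]_3).

Lemma lformE l : lform l = l 0 (inord 0) *: 'X_(inord 0)
  + l 0 (inord 1) *: 'X_(inord 1) + l 0 (inord 2) *: 'X_(inord 2).
Proof. exact: sum_ord3. Qed.

Lemma qformE a : let c (k : nat) := a 0 (inord k) in
    let X (i : nat) := 'X_(inord i) : {mpoly R[3]} in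
  qform a = c 0%N *: (X 0%N * X 0%N) + c 1%N *: (X 0%N * X 1%N)
    + c 2%N *: (X 0%N * X 2%N) + c 3%N *: (X 1%N * X 1%N)
    + c 4%N *: (X 1%N * X 2%N) + c 5%N *: (X 2%N * X 2%N).
Proof.
rewrite /qform sum_ord3 !(big_mkcond (fun j => _ <= _)%N) !sum_ord3.
by rewrite !inordK //= !sidx_inord //= !addrA !addr0.
Qed.

Lemma qformZ c a : qform (c *: a) = c *: qform a.
Proof. by rewrite !qformE !mxE !scalerDr !scalerA. Qed.

Lemma lformM l m : lform l * lform m = qform (prod_form l m).
Proof.
rewrite qformE prod_formE !row6E //= !lformE -!mul_mpolyC !mpolyCD !mpolyCM.
ring.
Qed.

(** The monomials [X_i X_j] with [i <= j] are distinct, so each coefficient of the vector can be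
    read off the polynomial. *)
Lemma qform_inj : injective (@qform R).
Proof.
suff coefE a (i j : 'I_3) : (i <= j)%N ->
    (qform a)@_(U_(i) + U_(j))%MM = a 0 (sidx i j).
  move=> a b eq_ab; rewrite [LHS]row6_eta [RHS]row6_eta.
  have E (i j : nat) : (i < 3)%N -> (j < 3)%N -> (i <= j)%N ->
      a 0 (sidx (inord i) (inord j)) = b 0 (sidx (inord i) (inord j)).
    by move=> i3 j3 ij; rewrite -!coefE ?eq_ab // !inordK.
  by congr row6; [have := E 0%N 0%N | have := E 0%N 1%N | have := E 0%N 2%N
    | have := E 1%N 1%N | have := E 1%N 2%N | have := E 2%N 2%N];
    rewrite !sidx_inord //=; apply.
move=> le_ij; rewrite /qform raddf_sum (bigD1 i) //= raddf_sum (bigD1 j) //=.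
have XE (k l : 'I_3) : (k <= l)%N ->
    ('X_k * 'X_l : {mpoly R[3]})@_(U_(i) + U_(j))%MM =
    ((k == i) && (l == j))%:R.
  move=> le_kl; rewrite -mpolyXD mcoeffX; congr (_%:R); congr (nat_of_bool _).
  (* Comparing the exponents at [i], [j], [k] and [l] suffices; all values of the four indices are
     then checked. *)
  apply/eqP/andP => [/mnmP eqU|[/eqP-> /eqP->] //].
  move: (eqU i) (eqU j) (eqU k) (eqU l); rewrite !mnmDE !mnm1E !eqxx -!val_eqE.
  move: i j k l le_ij le_kl {eqU} => [i i3] [j j3] [k k3] [l l3] /=.
  by move: i j k l i3 j3 k3 l3 =>
    [|[|[|//]]] [|[|[|//]]] [|[|[|//]]] [|[|[|//]]].
rewrite mcoeffZ XE // !eqxx mulr1.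
rewrite [X in _ + X]big1 => [|k neq]; last first.
  by rewrite raddf_sum big1 //= => l le_kl;
    rewrite mcoeffZ XE // (negPf neq) mulr0.
rewrite big1 => [|k /andP[le_ik neq]]; first by rewrite !addr0.
by rewrite mcoeffZ XE // (negPf neq) andbF mulr0.
Qed.

End QuadraticForms.

Lemma map_qform (R S : finFieldType) (f : {rmorphism R -> S}) (a : 'rV[R]_6) :
  map_mpoly f (qform a) = qform (map_mx f a).
Proof.
by rewrite !qformE !mxE !rmorphD /= !map_mpolyZ !rmorphM /= !map_mpolyX.
Qed.

Lemma card_imset_fibers (T U : finType) (f : T -> U) (D : {set T}) (k : nat) :
  {in D, forall x, #|[set y in D | f y == f x]| = k} ->
  #|D| = (#|f @: D| * k)%N.
Proof.
move=> fib; rewrite -sum1_card (partition_big_imset f) -sum_nat_const.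
apply: eq_bigr => _ /imsetP[x Dx ->]; rewrite -(fib x Dx) -sum1_card.
by apply: eq_bigl => y; rewrite inE.
Qed.

(** * Hyperplanes containing a line of the orbit *)

Section Hyperplanes.
Variable F : finFieldType.
Implicit Types (a b : 'rV[F]_6) (P : pred 'rV[F]_6) (L : {vspace 'rV[F]_6}).

Lemma hyperplaneZ (c : F) a : c != 0 -> hyperplane (c *: a) = hyperplane a.
Proof.
move=> c0; apply/setP => y; rewrite !inE.
under eq_bigr do rewrite mxE -mulrA.
by rewrite -mulr_sumr mulf_eq0 (negPf c0).
Qed.

Lemma hyperplane_eq a b : a != 0 -> b != 0 ->
  (hyperplane b == hyperplane a) = [exists c, (c != 0) && (b == c *: a)].
Proof.
move=> /rV0Pn[k ak] /rV0Pn[l bl].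
apply/eqP/existsP => [eq_ba | [c /andP[c0 /eqP->]]]; last exact: hyperplaneZ.
have eq_k j : b 0 k * a 0 j = a 0 k * b 0 j.
  (* The vector [a_j e_k - a_k e_j] lies in the hyperplane of [a], hence in that of [b]; this gives
     the proportion between [a] and [b]. *)
  pose y : 'rV[F]_6 := \row_i (a 0 j * (i == k)%:R - a 0 k * (i == j)%:R).
  have dot (d : 'rV[F]_6) :
      \sum_i d 0 i * y 0 i = a 0 j * d 0 k - a 0 k * d 0 j.
    have sum_delta (x : F) k' : \sum_i d 0 i * x *+ (i == k') = x * d 0 k'.
      rewrite (bigD1 k') //= eqxx mulr1n big1 ?addr0 1?mulrC // => i /negPf->.
      by rewrite mulr0n.
    rewrite -!sum_delta -sumrB; apply: eq_bigr => i _.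
    by rewrite mxE mulrBr !mulrA !mulr_natr.
  have : y \in hyperplane b by rewrite eq_ba inE dot mulrC subrr.
  by rewrite inE dot subr_eq0 => /eqP <-; rewrite mulrC.
exists (b 0 k / a 0 k); apply/andP; split.
  rewrite mulf_neq0 ?invr_neq0 //; apply: contra_neq bl => bk.
  by have /esym/eqP := eq_k l; rewrite bk mul0r mulf_eq0 (negPf ak) => /eqP.
by apply/eqP/rowP => j; rewrite mxE mulrAC eq_k mulrC mulKf.
Qed.

(** Incidence is the trace pairing of [form_mx a] with the symmetric matrix of the point. Cyclicity
    of the trace moves [A] and [A^T] onto the form, and against [o6_mx x y] the pairing is [x] times
    the first plus [y] times the second coefficient of [subst A a]. *)
Lemma o6_sub_hyperplane L (A : 'M[F]_3) a :
  [set symm y | y in L] = [set A *m M *m A^T | M in o6_rep F] ->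
  (L \subset hyperplane a) =
  (subst A a 0 (inord 0) == 0) && (subst A a 0 (inord 1) == 0).
Proof.
pose dual (M : 'M[F]_3) := \tr (form_mx a *m M).
have dual_symm y : dual (symm y) = \sum_k a 0 k * y 0 k.
  rewrite sum_ord6 /dual /mxtrace !(mxE, sum_ord3) !inordK //= !sidx_inord //=.
  by ring.
have dual_o6 x y : dual (A *m o6_mx x y *m A^T) =
    x * subst A a 0 (inord 0) + y * subst A a 0 (inord 1).
  rewrite /dual mulmxA mxtrace_mulC !mulmxA /subst /mx_form !row6E //=.
  move: (A^T *m _ *m _) => N.
  by rewrite /mxtrace !(mxE, sum_ord3) !inordK //=; ring.
move=> eqL; have -> : (L \subset hyperplane a) =
    [forall M in [set symm y | y in L], dual M == 0].
  apply/subsetP/forall_inP => [La _ /imsetP[y Ly ->] | La y Ly].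
    by rewrite dual_symm; have := La y Ly; rewrite inE.
  by rewrite inE -dual_symm La // imset_f.
rewrite eqL; apply/forall_inP/andP => 
    [La | [/eqP s0 /eqP s1] _ /imsetP[M Mo ->]].
  have o6P x y : dual (A *m o6_mx x y *m A^T) = 0.
    by apply/eqP/La/imset_f/imsetP; exists (x, y).
  have := (o6P 1 0, o6P 0 1).
  by rewrite !dual_o6 !mul1r !mul0r add0r addr0 => -[-> ->].
by case/imsetP: Mo => xy _ ->; rewrite dual_o6 s0 s1 !mulr0 addr0.
Qed.

(** The first clause makes [P] a property of hyperplanes, the second a property of their orbits
    under [K]. *)
Definition projectively_invariant P :=
  (forall (c : F) a, c != 0 -> P a -> P (c *: a)) /\
  (forall (A : 'M[F]_3) a, A \in unitmx -> P a -> P (subst A a)).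

Lemma card_hyperplanes_o6 P L : in_o6 L -> projectively_invariant P ->
  (#|[set H in hyperplanes P | L \subset H]| * #|F|.-1)%N =
  #|[set a | [&& a != 0, P a, a 0 (inord 0) == 0 & a 0 (inord 1) == 0]]|.
Proof.
case=> A Au eqL [PZ PA].
pose D := [set a | [&& a != 0, P a & L \subset hyperplane a]].
have -> : [set H in hyperplanes P | L \subset H] = @hyperplane F @: D.
  apply/setP => H; rewrite inE; apply/andP/imsetP => [[/imsetP[a]]|[a]].
    rewrite inE => /andP[/= a0 Pa] -> La; exists a => //.
    by rewrite inE a0 Pa.
  rewrite inE => /and3P[a0 Pa La] ->; split=> //.
  by apply: imset_f; rewrite inE /= a0.
have substK (B : 'M[F]_3) :
    B \in unitmx -> cancel (subst B) (subst (invmx B)) => [Bu a|].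
  by rewrite substM mulmxV ?subst1.
have subst0 (B : 'M[F]_3) : subst B 0 = 0.
  by rewrite -(scale0r 0) substZ !scale0r.
have subst_neq0 (B : 'M[F]_3) a : B \in unitmx -> (subst B a != 0) = (a != 0).
  by move=> Bu; rewrite -{1}(subst0 B) (inj_eq (can_inj (substK B Bu))).
(* Each hyperplane comes from exactly the [q - 1] nonzero multiples of one vector. *)
rewrite -(card_imset_fibers _ _ (@hyperplane F) D); last first.
  move=> a; rewrite inE => /and3P[a0 Pa La].
  have -> : [set b in D | hyperplane b == hyperplane a] =
      [set c *: a | c in [set~ 0]].
    apply/setP => b; apply/idP/imsetP => [|[c]].
      rewrite inE => /andP[]; rewrite inE => /and3P[b0 Pb Lb].
      rewrite hyperplane_eq // => /existsP[c /andP[c0 /eqP->]].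
      by exists c => //; rewrite !inE.
    rewrite !inE => c0 ->; rewrite hyperplaneZ // eqxx La PZ //.
    by rewrite scaler_eq0 negb_or c0 a0.
  rewrite card_imset ?cardsC1 // => c d /eqP.
  by rewrite -subr_eq0 -scalerBl scaler_eq0 (negPf a0) orbF subr_eq0 => /eqP.
(* [subst A] carries the vectors of hyperplanes through [L] bijectively to those with
   [a_00 = a_01 = 0]. *)
rewrite -(card_imset _ (can_inj (substK A Au))).
congr #|pred_of_set _|; apply/setP => b; rewrite inE.
apply/imsetP/and4P => [[a]|[b0 Pb s0 s1]].
  rewrite inE (o6_sub_hyperplane L A) // => /and4P[a0 Pa s0 s1] ->.
  by rewrite subst_neq0 // PA.
have substVK : subst A (subst (invmx A) b) = b.
  by rewrite substM mulVmx ?subst1.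
exists (subst (invmx A) b) => //.
rewrite inE (o6_sub_hyperplane L A) // substVK s0 s1.
by rewrite subst_neq0 ?PA ?unitmx_inv ?b0.
Qed.

End Hyperplanes.

(** * The map [x ^+ q] on the extension field *)

Section Frobenius.
Variables (F E : finFieldType) (iota : {rmorphism F -> E}).

(** [#|F|] is a power of the characteristic of [F], which [iota] makes the characteristic of [E] as
    well. *)
Lemma frobD (x y : E) : (x + y) ^+ #|F| = x ^+ #|F| + y ^+ #|F|.
Proof.
have [p p_pr pF] := finPcharP F; apply: exprDn_pchar.
have /abelem_pgroup := fin_ring_pchar_abelem pF.
rewrite /pgroup cardsT => pn.
rewrite (@eq_pnat _ (p : nat_pred)) // => r.
by rewrite (fmorph_pchar iota) (pcharf_eq pF).
Qed.

Lemma frob_iota (x : F) : iota x ^+ #|F| = iota x.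
Proof. by rewrite -rmorphXn expf_card. Qed.

(** The image of [iota] already supplies [q] roots of [X^q - X]; a fixed element outside it would be
    a root too many. *)
Lemma frob_fixed_codom (x : E) : (x ^+ #|F| == x) = (x \in codom iota).
Proof.
apply/eqP/codomP => [fx|[y ->]]; last exact: frob_iota.
pose p : {poly E} := 'X^#|F| - 'X.
have sz_p : size p = #|F|.+1.
  rewrite size_polyDl ?size_polyXn // size_polyN size_polyX ltnS.
  exact: finNzRing_gt1.
have p0 : p != 0 by rewrite -size_poly_eq0 sz_p.
apply/codomP; apply: contraT => nx.
have rp y : y ^+ #|F| = y -> root p y.
  by move=> fy; rewrite rootE !hornerE fy subrr.
have := max_poly_roots p0 (rs := x :: codom iota).
rewrite /= nx rp // sz_p size_codom ltnn => absurd; apply: absurd.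
  by apply/allP=> _ /codomP[y ->]; apply/rp/frob_iota.
by rewrite map_inj_uniq ?enum_uniq //; apply: fmorph_inj.
Qed.

Lemma conj_formM (l : 'rV[E]_3) (A : 'M[F]_3) :
  conj_form F (l *m map_mx iota A) = conj_form F l *m map_mx iota A.
Proof.
apply/rowP => j; rewrite !(mxE, sum_ord3) !frobD.
by rewrite !exprMn !frob_iota.
Qed.

End Frobenius.

(** * Projective invariance of the four types of conics *)

Section ConicTypes.
Variables (F E : finFieldType) (iota : {rmorphism F -> E}).
Implicit Types (a : 'rV[F]_6).

(** Injectivity of [qform] turns a factorisation of polynomials into an identity of coefficient
    vectors; the two kinds of line pairs are treated alike. *)
Lemma double_lineP a :
  reflect (exists c l, a = c *: prod_form l l) (double_line a).
Proof.
have eqf c l : (qform a == c *: lform l ^+ 2) = (a == c *: prod_form l l).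
  by rewrite expr2 lformM -qformZ (inj_eq (@qform_inj F)).
apply: (iffP existsP) => [[c /existsP[l]] | [c [l eq_a]]].
  by rewrite eqf => /eqP eq_a; exists c, l.
by exists c; apply/existsP; exists l; rewrite eqf eq_a.
Qed.

Lemma real_line_pairP a :
  reflect (exists l m, ~~ proportional l m /\ a = prod_form l m)
          (real_line_pair a).
Proof.
apply: (iffP existsP) => [[l /existsP[m /andP[lm]]] | [l [m [lm eq_a]]]].
  by rewrite lformM => /eqP/qform_inj ->; exists l, m.
by exists l; apply/existsP; exists m; rewrite lm lformM eq_a /=.
Qed.

Lemma imaginary_line_pairP a :
  reflect (exists c (l : 'rV[E]_3), ~~ proportional l (conj_form F l) /\
             map_mx iota a = iota c *: prod_form l (conj_form F l))
          (imaginary_line_pair iota a).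
Proof.
apply: (iffP existsP) => [[c /existsP[l /andP[ll]]] | [c [l [ll eq_a]]]].
  by rewrite map_qform lformM -qformZ => /eqP/qform_inj ->; exists c, l.
exists c; apply/existsP; exists l.
by rewrite ll map_qform lformM -qformZ eq_a /=.
Qed.

Lemma double_line_invariant : projectively_invariant F (@double_line F).
Proof.
split=> [d a _ | A a _] /double_lineP[c [l ->]]; apply/double_lineP.
  by exists (d * c), l; rewrite scalerA.
by exists c, (l *m A); rewrite substZ subst_prod_form.
Qed.

Lemma proportional_mul (R : finFieldType) (A : 'M[R]_3) (l m : 'rV[R]_3) :
  A \in unitmx -> proportional (l *m A) (m *m A) = proportional l m.
Proof.
move=> Au; apply: eq_existsb => c; rewrite !scalemxAl.
by rewrite !(inj_eq (can_inj (mulmxK Au))).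
Qed.

Lemma real_line_pair_invariant : projectively_invariant F (@real_line_pair F).
Proof.
split=> [d a d0 | A a Au] /real_line_pairP[l [m [lm ->]]];
  apply/real_line_pairP.
  (* A real pair carries no separate scalar, so [d] is absorbed into the first factor. *)
  exists (d *: l), m; split; last by rewrite prod_formZl.
  apply: contra lm => /existsP[c /orP[] /eqP eq_c]; apply/existsP.
    by exists (d^-1 * c); rewrite -scalerA -eq_c scalerA mulVf // scale1r eqxx.
  by exists (c * d); rewrite -!scalerA -eq_c eqxx orbT.
by exists (l *m A), (m *m A); rewrite proportional_mul // subst_prod_form.
Qed.

Lemma imaginary_line_pair_invariant :
  projectively_invariant F (imaginary_line_pair iota).
Proof.
split=> [d a d0 | A a Au] /imaginary_line_pairP[c [l [ll eq_a]]];
  apply/imaginary_line_pairP.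
  by exists (d * c), l; split; rewrite // map_mxZ eq_a scalerA rmorphM.
exists c, (l *m map_mx iota A).
rewrite conj_formM proportional_mul ?map_unitmx //.
by rewrite map_subst eq_a substZ subst_prod_form.
Qed.

Lemma conic_discE (a : 'rV[F]_6) : let c (k : nat) := a 0 (inord k) in
  conic_disc a = 4%:R * c 0%N * c 3%N * c 5%N + c 1%N * c 2%N * c 4%N
    - c 0%N * c 4%N ^+ 2 - c 3%N * c 2%N ^+ 2 - c 5%N * c 1%N ^+ 2.
Proof. by rewrite /conic_disc !sidx_inord. Qed.

(* [d] is the determinant of [A]. *)
Lemma conic_disc_subst (A : 'M[F]_3) a :
  exists d, conic_disc (subst A a) = d ^+ 2 * conic_disc a.
Proof.
pose m (i j : nat) := A (inord i) (inord j).
exists (m 0%N 0%N * (m 1%N 1%N * m 2%N 2%N - m 1%N 2%N * m 2%N 1%N)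
  - m 0%N 1%N * (m 1%N 0%N * m 2%N 2%N - m 1%N 2%N * m 2%N 0%N)
  + m 0%N 2%N * (m 1%N 0%N * m 2%N 1%N - m 1%N 1%N * m 2%N 0%N)).
rewrite !conic_discE /subst /mx_form !row6E //= /m !(mxE, sum_ord3).
by rewrite !inordK //= !sidx_inord //=; ring.
Qed.

Lemma nonsingular_invariant : projectively_invariant F (@nonsingular F).
Proof.
split=> [c a c0 | A a Au]; rewrite /nonsingular.
  have -> : conic_disc (c *: a) = c ^+ 3 * conic_disc a.
    by rewrite !conic_discE !mxE; ring.
  by rewrite mulf_eq0 expf_eq0 (negPf c0) andbF.
(* Substituting back by the inverse writes the discriminant of [a] as a multiple of that of
   [subst A a], which therefore cannot vanish; [d] need not be shown nonzero beforehand. *)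
have [d] := conic_disc_subst (invmx A) (subst A a).
by rewrite substM mulmxV // subst1 => ->; rewrite mulf_eq0 negb_or => /andP[].
Qed.

End ConicTypes.

(** * Nonsingular conics and double lines with [a_00 = a_01 = 0] *)

Section Counting.
Variables (F E : finFieldType) (iota : {rmorphism F -> E}).
Implicit Types (a : 'rV[F]_6) (c s p u v t : F).

(* [a_00 = a_01 = 0] says that the restriction of the conic to [X_2 = 0] is a
   multiple of [X_1 ^+ 2]. *)
Definition tangent_forms (P : pred 'rV[F]_6) : {set 'rV[F]_6} :=
  [set a | [&& a != 0, P a, a 0 (inord 0) == 0 & a 0 (inord 1) == 0]].

Lemma row6_eq0 (x0 x1 x2 x3 x4 x5 : F) :
  (row6 x0 x1 x2 x3 x4 x5 == 0) =
  [&& x0 == 0, x1 == 0, x2 == 0, x3 == 0, x4 == 0 & x5 == 0].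
Proof.
have -> : 0 = row6 0 0 0 0 0 0 :> 'rV[F]_6.
  by rewrite [LHS]row6_eta !mxE.
apply/eqP/and5P => [/row6_inj[-> -> -> [-> -> ->]]|]; first by rewrite eqxx.
by case=> /eqP-> /eqP-> /eqP-> /eqP-> /andP[/eqP-> /eqP->].
Qed.

Lemma tangent_formsE (P : pred 'rV[F]_6) x0 x1 x2 x3 x4 x5 :
  (row6 x0 x1 x2 x3 x4 x5 \in tangent_forms P) =
  [&& x0 == 0, x1 == 0, [|| x2 != 0, x3 != 0, x4 != 0 | x5 != 0] &
    P (row6 x0 x1 x2 x3 x4 x5)].
Proof.
rewrite inE !row6E //= row6_eq0 !negb_and.
by case: (x0 == 0); case: (x1 == 0); rewrite /= ?andbF ?andbT.
Qed.

(** The form [c X_1^2 + s X_1 X_2 + p X_2^2]. For [c (X_1 + u X_2)(X_1 + v X_2)], [s] and [p] are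
    [c] times the sum and the product of [u] and [v]. *)
Definition binary_form c s p : 'rV[F]_6 := row6 0 0 0 c s p.

Lemma tangent_nonsingular : tangent_forms (@nonsingular F) =
  [set row6 0 0 x.1.1 x.1.2 x.2.1 x.2.2
    | x in setX (setX [set~ 0] [set~ 0]) (setX [set: F] [set: F])].
Proof.
apply/setP => a; rewrite [a]row6_eta tangent_formsE.
rewrite /nonsingular conic_discE !row6E //=.
set x0 := a 0 _; set x1 := a 0 _; set x2 := a 0 _; set x3 := a 0 _.
set x4 := a 0 _; set x5 := a 0 _.
apply/and4P/imsetP => [[/eqP-> /eqP-> _ disc]|[[[y2 y3] [y4 y5]]]].
  exists ((x2, x3), (x4, x5)) => //; rewrite !inE /= !andbT.
  rewrite -negb_or; apply: contra disc => /orP[] /eqP->; apply/eqP; ring.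
rewrite !inE /= !andbT => /andP[y20 y30] /row6_inj[-> -> -> [-> -> ->]].
rewrite !eqxx y20 /=; split=> //.
have -> : 4%:R * 0 * y3 * y5 + 0 * y2 * y4 - 0 * y4 ^+ 2 - y3 * y2 ^+ 2
  - y5 * 0 ^+ 2 = - (y3 * y2 ^+ 2) by ring.
by rewrite oppr_eq0 mulf_neq0 ?expf_neq0.
Qed.

(** [a_00 = 0] removes [X_0] from the linear form. If [X_1] occurs, the form is normalised to
    [c (X_1 + t X_2)^2]; otherwise it is [c X_2^2]. *)
Lemma tangent_double_line : tangent_forms (@double_line F) =
  [set binary_form x.1 (2%:R * x.1 * x.2) (x.1 * x.2 ^+ 2)
    | x in setX [set~ 0] [set: F]] :|:
  [set binary_form 0 0 c | c in [set~ 0]].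
Proof.
apply/setP => a; apply/idP/setUP => [|[] /imsetP].
- rewrite inE => /and4P[a0 /double_lineP[c [l def_a]]].
  move: a0; rewrite def_a prod_formE.
  move: (l 0 (inord 0)) (l 0 (inord 1)) (l 0 (inord 2)) => x y z.
  rewrite !mxE !inordK //= => nz.
  have c0 : c != 0 by apply: contra_neq nz => ->; rewrite scale0r.
  rewrite mulf_eq0 (negPf c0) mulf_eq0 orbb => /eqP x0 _.
  rewrite {}x0 in nz *.
  have scaleE : c *: row6 (0 * 0) (0 * y + y * 0) (0 * z + z * 0) (y * y)
      (y * z + z * y) (z * z) =
      binary_form (c * y ^+ 2) (2%:R * c * y * z) (c * z ^+ 2).
    rewrite [LHS]row6_eta !mxE !inordK //=.
    by congr row6; ring.
  rewrite scaleE; have [y0|y0] := eqVneq y 0.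
    right; apply/imsetP; exists (c * z ^+ 2); last first.
      by rewrite y0; congr row6; ring.
    rewrite !inE mulf_neq0 ?expf_neq0 //; apply: contra_neq nz => z0.
    by rewrite scaleE y0 z0 !expr0n !mulr0; apply/eqP; rewrite row6_eq0 !eqxx.
  left; apply/imsetP; exists (c * y ^+ 2, z / y).
    by rewrite !inE /= mulf_neq0 ?expf_neq0.
  by congr row6; rewrite /=; field.
- case=> -[c t] /setXP[]; rewrite in_setC1 => c0 _ ->.
  rewrite tangent_formsE !eqxx c0 /=.
  apply/double_lineP; exists c, (\row_i nth 0 [:: 0; 1; t] i).
  rewrite prod_formE [RHS]row6_eta !mxE !inordK //=.
  by congr row6; ring.
case=> c; rewrite in_setC1 => c0 ->.
rewrite tangent_formsE !eqxx c0 /=.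
apply/double_lineP; exists c, (\row_i nth 0 [:: 0; 0; 1] i).
rewrite prod_formE [RHS]row6_eta !mxE !inordK //=.
by congr row6; ring.
Qed.

End Counting.

(** * Line pairs with [a_00 = a_01 = 0] *)

Lemma prod_formC (R : comNzRingType) (l m : 'rV[R]_3) :
  prod_form l m = prod_form m l.
Proof. by rewrite !prod_formE; congr row6; ring. Qed.

Lemma proportional_sym (R : finFieldType) (l m : 'rV[R]_3) :
  proportional l m = proportional m l.
Proof. by apply: eq_existsb => c; rewrite orbC. Qed.

(** The hypotheses leave one 2 by 2 determinant, which vanishes. The multiplier is the ratio at a
    nonzero coordinate of [l], or 0 when [l] is zero. *)
Lemma proportional_binary (R : finFieldType) (l m : 'rV[R]_3) :
  l 0 (inord 0) = 0 -> m 0 (inord 0) = 0 ->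
  l 0 (inord 1) * m 0 (inord 2) = l 0 (inord 2) * m 0 (inord 1) ->
  proportional l m.
Proof.
have eq_row3 (x y : 'rV[R]_3) : x 0 (inord 0) = y 0 (inord 0) ->
    x 0 (inord 1) = y 0 (inord 1) -> x 0 (inord 2) = y 0 (inord 2) -> x = y.
  move=> e0 e1 e2; apply/rowP; apply: ord_inordP => k.
  by case: k => [|[|[|]]].
move=> l0 m0 lm; apply/existsP.
have [l1|l1] := eqVneq (l 0 (inord 1)) 0; last first.
  exists (m 0 (inord 1) / l 0 (inord 1)); apply/orP; right; apply/eqP.
  apply: eq_row3; rewrite mxE ?l0 ?m0 ?mulr0 ?divfK //.
  by apply: (mulfI l1); rewrite lm; field.
have [l2|l2] := eqVneq (l 0 (inord 2)) 0.
  by exists 0; apply/orP; left; apply/eqP; apply: eq_row3; rewrite mxE mul0r.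
exists (m 0 (inord 2) / l 0 (inord 2)); apply/orP; right; apply/eqP.
apply: eq_row3; rewrite mxE ?l0 ?m0 ?mulr0 ?divfK //.
by apply: (mulfI l2); rewrite -lm l1; field.
Qed.

Section Pairs.
Variables (F E : finFieldType) (iota : {rmorphism F -> E}).
Implicit Types (a : 'rV[F]_6) (c s p u v t : F).

(** Products of [X_2] with a linear form not proportional to [X_2]. *)
Definition tangent_pair_forms : {set 'rV[F]_6} :=
  [set row6 0 0 x.1.1 0 x.1.2 x.2 | x in setX [set~ (0, 0)] [set: F]].

(** The forms [c (X_1 + u X_2)(X_1 + v X_2)] with [c] nonzero and [u], [v] distinct in [F]. *)
Definition split_binary_forms : {set 'rV[F]_6} :=
  [set binary_form F x.1 (x.1 * (x.2.1 + x.2.2)) (x.1 * (x.2.1 * x.2.2))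
    | x in setX [set~ 0] [set x : F * F | x.1 != x.2]].

Lemma tangent_real_line_pair : tangent_forms F (@real_line_pair F) =
  tangent_pair_forms :|: split_binary_forms.
Proof.
apply/setP => a; apply/idP/setUP => [|[] /imsetP].
(* If [X_0] occurs in one factor, [a_00 = a_01 = 0] forces the other to be a multiple of [X_2],
   nonzero because the zero form is proportional to every form. *)
- have skew (l m : 'rV[F]_3) : ~~ proportional l m -> l 0 (inord 0) != 0 ->
      l 0 (inord 0) * m 0 (inord 0) = 0 ->
      l 0 (inord 0) * m 0 (inord 1) + l 0 (inord 1) * m 0 (inord 0) = 0 ->
      prod_form l m \in tangent_pair_forms.
    move=> lm l0 /eqP; rewrite mulf_eq0 (negPf l0) /= => /eqP m0 /eqP.
    rewrite m0 mulr0 addr0 mulf_eq0 (negPf l0) /= => /eqP m1.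
    have m2 : m 0 (inord 2) != 0.
      apply: contra lm => /eqP m2; apply/existsP; exists 0; apply/orP; right.
      apply/eqP/rowP; apply: ord_inordP => k.
      by case: k => [|[|[|]]] // _; rewrite mxE mul0r.
    apply/imsetP; exists (l 0 (inord 0) * m 0 (inord 2),
      l 0 (inord 1) * m 0 (inord 2), l 0 (inord 2) * m 0 (inord 2)).
      rewrite in_setX in_setT andbT in_setC1 /= xpair_eqE negb_and.
      by rewrite mulf_neq0.
    by rewrite prod_formE m0 m1; congr row6; rewrite /=; ring.
  rewrite inE => /and4P[_ /real_line_pairP[l [m [lm ->]]]].
  move=> e0 e1; move: (e0) (e1); rewrite {1 2}prod_formE !row6E //=.
  move=> /eqP eq0 /eqP eq1 {e0 e1}.
  have [l0|l0] := eqVneq (l 0 (inord 0)) 0; last by left; apply: skew.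
  have [m0|m0] := eqVneq (m 0 (inord 0)) 0; last first.
    left; rewrite prod_formC; apply: skew => //.
    - by rewrite proportional_sym.
    - by rewrite mulrC.
    by rewrite -eq1; ring.
  have det : l 0 (inord 1) * m 0 (inord 2) != l 0 (inord 2) * m 0 (inord 1).
    by apply: contra lm => /eqP; apply: proportional_binary.
  rewrite prod_formE l0 m0.
  move: (l 0 (inord 1)) (l 0 (inord 2)) (m 0 (inord 1)) (m 0 (inord 2)) det.
  move=> l1 l2 m1 m2 det.
  (* Neither factor contains [X_0]. Either one of them is a multiple of [X_2], or both can be scaled
     to have coefficient 1 at [X_1]. *)
  have [lm1|lm1] := eqVneq (l1 * m1) 0.
    left; apply/imsetP; exists (0, l1 * m2 + l2 * m1, l2 * m2); last first.
      by rewrite lm1; congr row6; rewrite /=; ring.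
    rewrite in_setX in_setT andbT in_setC1 /= xpair_eqE eqxx /=.
    move/eqP: lm1; rewrite mulf_eq0 => /orP[] /eqP z.
      by move: det; rewrite z !mul0r add0r eq_sym.
    by move: det; rewrite z !mulr0 addr0.
  have [l1n0 m1n0] : l1 != 0 /\ m1 != 0.
    by apply/andP; rewrite -negb_or -mulf_eq0.
  right; apply/imsetP; exists (l1 * m1, (l2 / l1, m2 / m1)).
    rewrite in_setX in_setC1 lm1 inE /= -subr_eq0.
    have -> : l2 / l1 - m2 / m1 = - (l1 * m2 - l2 * m1) / (l1 * m1).
      by field; rewrite ?l1n0 ?m1n0.
    by rewrite mulf_neq0 ?invr_neq0 // oppr_eq0 subr_eq0.
  by congr row6; rewrite /= ?mul0r ?addr0 //; field; rewrite ?l1n0 ?m1n0.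
- case=> -[[x2 x4] x5] /setXP[]; rewrite in_setC1.
  rewrite xpair_eqE negb_and /= => nz _ ->.
  rewrite tangent_formsE !eqxx /=; apply/andP; split.
    by case/orP: nz => ->; rewrite ?orbT.
  apply/real_line_pairP.
  exists (\row_i nth 0 [:: 0; 0; 1] i), (\row_i nth 0 [:: x2; x4; x5] i).
  split; last first.
    by rewrite prod_formE !mxE !inordK //=; congr row6; ring.
  apply: contraL nz => /existsP[c /orP[] /eqP/rowP eq_c].
    have := (eq_c (inord 0), eq_c (inord 1), eq_c (inord 2)).
    rewrite !mxE !inordK //= => -[[e0 e1] e2].
    have c0 : c != 0.
      by apply/eqP => z; move/eqP: e2; rewrite z mul0r oner_eq0.
    move/esym/eqP: e0; move/esym/eqP: e1.
    by rewrite !mulf_eq0 (negPf c0) /= => -> ->.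
  have := (eq_c (inord 0), eq_c (inord 1)).
  by rewrite !mxE !inordK //= mulr0 => -[-> ->]; rewrite eqxx.
case=> -[c [u v]] /setXP[]; rewrite in_setC1 inE /= => c0 uv ->.
rewrite tangent_formsE !eqxx c0 /=; apply/real_line_pairP.
exists (\row_i nth 0 [:: 0; c; c * u] i), (\row_i nth 0 [:: 0; 1; v] i).
split; last by rewrite prod_formE !mxE !inordK //=; congr row6; ring.
apply: contra uv => /existsP[d /orP[] /eqP/rowP eq_d].
  have := (eq_d (inord 1), eq_d (inord 2)).
  by rewrite !mxE !inordK //= mulr1 => -[<-] /(mulfI c0) ->.
have := (eq_d (inord 1), eq_d (inord 2)).
by rewrite !mxE !inordK //= mulrA => -[<- ->]; rewrite mul1r.
Qed.

Hypothesis cardE : #|E| = (#|F| ^ 2)%N.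

(** A left inverse of [iota]. It is applied below to traces and norms, which lie in the image, so
    the default 0 is not met there. *)
Definition iota_inv (x : E) : F := odflt 0 [pick y | iota y == x].

Lemma iota_invK (x : E) : x ^+ #|F| = x -> iota (iota_inv x) = x.
Proof.
move/eqP; rewrite (frob_fixed_codom F E iota) => /codomP[y ->].
by rewrite /iota_inv; case: pickP => [z /eqP //|/(_ y)]; rewrite eqxx.
Qed.

Lemma frobK (x : E) : (x ^+ #|F|) ^+ #|F| = x.
Proof. by rewrite -exprM mulnn -cardE expf_card. Qed.

(** The [q]-th power exchanges [x] and [x ^+ #|F|], hence fixes their sum, and likewise their
    product. *)
Lemma iota_trace (x : E) : iota (iota_inv (x + x ^+ #|F|)) = x + x ^+ #|F|.
Proof. by apply: iota_invK; rewrite (frobD F E iota) frobK addrC. Qed.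

Lemma iota_norm (x : E) : iota (iota_inv (x * x ^+ #|F|)) = x * x ^+ #|F|.
Proof. by apply: iota_invK; rewrite exprMn frobK mulrC. Qed.

(** [a_00] is [c] times the norm of the [X_0] coefficient of [l], so that coefficient vanishes.
    Non-proportionality then makes the [X_1] coefficient nonzero, and dividing by it leaves
    [X_1 + t X_2] and its conjugate, with [t] outside [F]. *)
Lemma tangent_imaginary_line_pair :
  tangent_forms F (imaginary_line_pair iota) =
  [set binary_form F x.1 (x.1 * iota_inv (x.2 + x.2 ^+ #|F|))
         (x.1 * iota_inv (x.2 * x.2 ^+ #|F|))
    | x in setX [set~ 0] [set t : E | t ^+ #|F| != t]].
Proof.
apply/setP => a; apply/idP/imsetP.
  rewrite inE => /and4P[a0 /imaginary_line_pairP[c [l [ll eq_a]]]].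
  have c0 : c != 0.
    apply: contra_neq a0 => c0; apply: (map_mx_inj (f := iota)).
    by rewrite eq_a c0 rmorph0 scale0r raddf0.
  have iota_a k : (k < 6)%N -> iota (a 0 (inord k)) =
      iota c * prod_form l (conj_form F l) 0 (inord k).
    by move=> k6; move/rowP/(_ (inord k)): eq_a; rewrite !mxE.
  have ic0 : iota c != 0 by rewrite fmorph_eq0.
  have conjE k : conj_form F l 0 k = l 0 k ^+ #|F| by rewrite mxE.
  rewrite -(fmorph_eq0 iota) iota_a // prod_formE row6E //= conjE -exprS.
  rewrite mulf_eq0 (negPf ic0) expf_eq0 /= => /eqP l0 /eqP a1.
  have q0 : (0 < #|F|)%N by rewrite (cardD1 0).
  have conj0 : conj_form F l 0 (inord 0) = 0.
    by rewrite conjE l0 expr0n -(prednK q0).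
  have det : l 0 (inord 1) * l 0 (inord 2) ^+ #|F| !=
      l 0 (inord 2) * l 0 (inord 1) ^+ #|F|.
    apply: contra ll => /eqP det; apply: proportional_binary => //.
    by rewrite !conjE.
  have l1 : l 0 (inord 1) != 0.
    by apply: contra_neq det => ->; rewrite expr0n -(prednK q0) mul0r mulr0.
  have l1q : l 0 (inord 1) ^+ #|F| != 0 by rewrite expf_neq0.
  have a2 : a 0 (inord 2) = 0.
    apply: (fmorph_inj iota); rewrite iota_a // prod_formE row6E //= l0 conj0.
    by rewrite rmorph0; ring.
  have a3 : iota (a 0 (inord 3)) =
      iota c * (l 0 (inord 1) * l 0 (inord 1) ^+ #|F|).
    by rewrite iota_a // prod_formE row6E //= !conjE.
  have a00 : a 0 (inord 0) = 0.
    apply: (fmorph_inj iota); rewrite iota_a // prod_formE row6E //= l0.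
    by rewrite rmorph0; ring.
  exists (a 0 (inord 3), l 0 (inord 2) / l 0 (inord 1)).
    rewrite in_setX in_setC1 inE /= -(fmorph_eq0 iota) a3 !mulf_neq0 //=.
    apply: contra det => /eqP; rewrite exprMn exprVn => det.
    (* The equality of [t] and its conjugate is multiplied by the norm of the [X_1] coefficient to
       clear denominators. *)
    apply/eqP; transitivity (l 0 (inord 2) ^+ #|F| / l 0 (inord 1) ^+ #|F| *
      (l 0 (inord 1) * l 0 (inord 1) ^+ #|F|)); first by field.
    by rewrite det; field.
  rewrite [LHS]row6_eta a00 a1 a2; congr row6 => /=;
    apply: (fmorph_inj iota); rewrite rmorphM.
    rewrite iota_trace a3 iota_a // prod_formE row6E //= !conjE exprMn exprVn.
    by field; rewrite l1 l1q.
  rewrite iota_norm a3 iota_a // prod_formE row6E //= !conjE exprMn exprVn.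
  by field; rewrite l1 l1q.
case=> -[c t] /setXP[]; rewrite in_setC1 inE /= => c0 tn ->.
rewrite tangent_formsE !eqxx c0 /=; apply/imaginary_line_pairP.
have q0 : (0 < #|F|)%N by rewrite (cardD1 0).
exists c, (\row_i nth 0 [:: 0; 1; t] i); split.
  (* The coefficients 1 at [X_1] force the multiplier to be 1, so proportionality would make [t]
     equal to its conjugate. *)
  apply: contra tn => /existsP[d /orP[] /eqP/rowP eq_d].
    have := (eq_d (inord 1), eq_d (inord 2)).
    by rewrite !mxE !inordK //= expr1n mulr1 => -[<-]; rewrite mul1r => <-.
  have := (eq_d (inord 1), eq_d (inord 2)).
  by rewrite !mxE !inordK //= expr1n mulr1 => -[<-]; rewrite mul1r => ->.
rewrite map_row6 prod_formE !rmorph0 !rmorphM iota_trace iota_norm.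
rewrite [RHS]row6_eta !mxE !inordK //= expr1n expr0n -(prednK q0).
by congr row6; rewrite /=; ring.
Qed.

End Pairs.

(** * Cardinalities of the four families of forms *)

Section Cardinals.
Variables (F E : finFieldType) (iota : {rmorphism F -> E}).
Local Notation q := #|F|.

Lemma card_tangent_nonsingular :
  #|tangent_forms F (@nonsingular F)| = (q.-1 * q.-1 * (q * q))%N.
Proof.
rewrite tangent_nonsingular card_imset ?cardsX ?cardsC1 ?cardsT //.
by move=> [[? ?] [? ?]] [[? ?] [? ?]] /row6_inj[_ _ /= -> [-> -> ->]].
Qed.

Lemma card_tangent_double_line :
  #|tangent_forms F (@double_line F)| = (q.-1 * q + q.-1)%N.
Proof.
rewrite tangent_double_line cardsU.
(* The coefficient [a_11] is nonzero in the first family and zero in the second. *)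
rewrite (_ : _ :&: _ = set0); last first.
  apply/setP => a; rewrite inE in_set0; apply/andP => -[/imsetP[[c t]]].
  move=> /setXP[]; rewrite in_setC1 /= => c0 _ -> /imsetP[d _].
  by case/row6_inj=> _ _ _ [c_eq0]; rewrite c_eq0 eqxx in c0.
rewrite cards0 subn0; congr (_ + _)%N.
  rewrite card_in_imset ?cardsX ?cardsC1 ?cardsT //.
  move=> [c t] [d s] /setXP[]; rewrite in_setC1 /= => c0 _ _.
  case/row6_inj=> _ _ _ [<- eq_s eq_p]; congr (_, _); apply/eqP.
  (* In characteristic 2 the middle coefficient does not determine [t]; the vanishing of
     [c (t - s)^2] gives equality in every characteristic. *)
  rewrite -subr_eq0 -sqrf_eq0 -(mulrI_eq0 _ (mulfI c0)).
  have -> : c * (t - s) ^+ 2 =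
      c * t ^+ 2 + c * s ^+ 2 - (2%:R * c * t) * s by ring.
  by rewrite eq_s eq_p; apply/eqP; ring.
by rewrite card_imset ?cardsC1 // => c d /row6_inj[_ _ _ [_ _ ->]].
Qed.

Lemma card_tangent_pair_forms :
  #|tangent_pair_forms F| = ((q * q).-1 * q)%N.
Proof.
rewrite card_imset ?cardsX ?cardsC1 ?cardsT ?card_prod //.
by move=> [[? ?] ?] [[? ?] ?] /row6_inj[_ _ /= -> [_ -> ->]].
Qed.

(** [a_11] gives [c], and the sum and product determine [u] and [v] up to order, so each form has
    exactly two parameters. *)
Lemma card_split_binary_forms :
  (#|split_binary_forms F| * 2)%N = (q.-1 * (q * q - q))%N.
Proof.
rewrite -(card_imset_fibers _ _ _ _ 2).
  rewrite cardsX cardsC1; congr (_ * _)%N.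
  have -> : [set x : F * F | x.1 != x.2] = ~: [set (u, u) | u : F].
    apply/setP => -[u v]; rewrite !inE /=; congr (~~ _).
    by apply/eqP/imsetP => [->|[w _ [-> ->]]]; first exists v.
  by rewrite cardsCs setCK card_prod card_imset // => u v [].
move=> [c [u v]]; rewrite in_setX in_setC1 inE /= => /andP[c0 uv].
rewrite [X in #|pred_of_set X|](_ : _ = [set (c, (u, v)); (c, (v, u))]).
  by rewrite cards2 !xpair_eqE negb_and negb_and uv orbT.
apply/setP => -[d [s t]].
rewrite inE in_setX in_setC1 in_set2 inE /= !xpair_eqE.
apply/andP/orP => [[_ /eqP/row6_inj[_ _ _ [->]]]|].
  move=> /(mulfI c0) eq_s /(mulfI c0) eq_p; rewrite eqxx /=.
  (* [s] is a root of the monic quadratic whose roots are [u] and [v]. *)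
  have : (s - u) * (s - v) == 0.
    have -> : (s - u) * (s - v) = s ^+ 2 - (u + v) * s + u * v by ring.
    by rewrite -eq_s -eq_p; apply/eqP; ring.
  rewrite mulf_eq0 !subr_eq0 => /orP[] /eqP eq_su; [left | right];
    move: eq_s; rewrite eq_su eqxx /=.
    by move/addrI->.
  by rewrite [u + v]addrC => /addrI->.
case=> /and3P[/eqP-> /eqP-> /eqP->]; rewrite c0 ?uv ?eqxx //.
by rewrite eq_sym uv; split=> //; apply/eqP; congr row6; ring.
Qed.

Lemma card_tangent_real_line_pair :
  (#|tangent_forms F (@real_line_pair F)| * 2)%N =
  ((q * q).-1 * q * 2 + q.-1 * (q * q - q))%N.
Proof.
rewrite tangent_real_line_pair cardsU.
rewrite (_ : _ :&: _ = set0); last first.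
  apply/setP => a; rewrite inE in_set0; apply/andP => -[/imsetP[y _ ->]].
  case/imsetP=> -[c uv] /setXP[]; rewrite in_setC1 /= => c0 _.
  by case/row6_inj=> _ _ _ [c_eq0]; rewrite -c_eq0 eqxx in c0.
by rewrite cards0 subn0 mulnDl card_tangent_pair_forms card_split_binary_forms.
Qed.

Hypothesis cardE : #|E| = (q ^ 2)%N.

(** Trace and norm determine [t] up to conjugation, so the [q^2 - q] elements outside the image of
    [iota] are used in pairs. *)
Lemma card_tangent_imaginary_line_pair :
  (#|tangent_forms F (imaginary_line_pair iota)| * 2)%N =
  (q.-1 * (q * q - q))%N.
Proof.
rewrite tangent_imaginary_line_pair // -(card_imset_fibers _ _ _ _ 2).
  rewrite cardsX cardsC1; congr (_ * _)%N.
  have -> : [set t : E | t ^+ q != t] = ~: [set iota x | x : F].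
    apply/setP => t; rewrite !inE (frob_fixed_codom F E iota); congr (~~ _).
    by apply/codomP/imsetP => [[x ->]|[x _ ->]]; exists x.
  by rewrite cardsCs setCK cardE card_imset ?mulnn //; apply: fmorph_inj.
move=> [c t]; rewrite in_setX in_setC1 inE /= => /andP[c0 tn].
rewrite [X in #|pred_of_set X|](_ : _ = [set (c, t); (c, t ^+ q)]).
  by rewrite cards2 !xpair_eqE negb_and eq_sym tn orbT.
apply/setP => -[d s]; rewrite inE in_setX in_setC1 in_set2 inE /= !xpair_eqE.
apply/andP/orP => [[_ /eqP/row6_inj[_ _ _ [->]]]|].
  move=> /(mulfI c0)/(congr1 iota) + /(mulfI c0)/(congr1 iota).
  rewrite !iota_trace // !iota_norm // eqxx /= => eq_s eq_p.
  apply/orP; rewrite -(subr_eq0 s) -(subr_eq0 s) -mulf_eq0.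
  have -> : (s - t) * (s - t ^+ q) = s ^+ 2 - (t + t ^+ q) * s + t * t ^+ q.
    by move: (t ^+ q) => t'; ring.
  by rewrite -eq_s -eq_p; move: (s ^+ q) => s'; apply/eqP; ring.
case=> /andP[/eqP-> /eqP->]; rewrite c0 ?tn ?eqxx // frobK // eq_sym tn.
by split=> //; apply/eqP; congr row6; congr (_ * iota_inv _ _ _ _);
  rewrite (addrC, mulrC).
Qed.

End Cardinals.

(** * Passage from numbers of forms to numbers of hyperplanes *)

Theorem lemma4p3 (q : nat) (F E : finFieldType) (iota : {rmorphism F -> E})
    (cardF : #|F| = q) (cardE : #|E| = (q ^ 2)%N)
    (L : {vspace 'rV[F]_6}) (L_line : \dim L = 2%N) (L_o6 : in_o6 L) :
  OD4 iota L =
    [:: q + 1; (3 * q ^ 2 + q) %/ 2; (q ^ 2 - q) %/ 2; q ^ 3 - q ^ 2]%N.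
Proof.
have q1 : (1 < q)%N by rewrite -cardF finNzRing_gt1.
have h1 := card_hyperplanes_o6 F _ L L_o6 (double_line_invariant F).
have h2r := card_hyperplanes_o6 F _ L L_o6 (real_line_pair_invariant F).
have h2i := card_hyperplanes_o6 F _ L L_o6
  (imaginary_line_pair_invariant F E iota).
have h3 := card_hyperplanes_o6 F _ L L_o6 (nonsingular_invariant F).
have := card_tangent_double_line F; have := card_tangent_real_line_pair F.
have := card_tangent_imaginary_line_pair F E iota.
have := card_tangent_nonsingular F.
rewrite /tangent_forms -h1 -h2r -h2i -h3 cardF {h1 h2r h2i h3}.
rewrite /OD4 /= /hyp1 /hyp2r /hyp2i /hyp3.
move: (#|[set H in hyperplanes _ | _]|)
  (#|[set H in hyperplanes (@real_line_pair F) | _]|)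
  (#|[set H in hyperplanes (imaginary_line_pair iota) | _]|)
  (#|[set H in hyperplanes (@nonsingular F) | _]|) => n1 n2r n2i n3.
move=> e3 /(_ cardE) e2i e2r e1.
(* Writing [q = k + 1] turns the truncated subtractions into products, and the factor [k], the
   number of nonzero scalars, can be cancelled. *)
case: q q1 e3 e2i e2r e1 {cardF cardE} => [//|k].
have -> : (k.+1 * k.+1).-1 = (k * k.+2)%N by lia.
rewrite ltnS !succnK => k0.
have -> : (k.+1 * k.+1 - k.+1 = k.+1 * k)%N.
  by rewrite -[X in (_ - X)%N]muln1 -mulnBr subn1.
have -> : (k.+1 ^ 3 - k.+1 ^ 2 = k.+1 ^ 2 * k)%N.
  by rewrite expnS mulnC -[X in (_ - X)%N]muln1 -mulnBr subn1.
have cancel m n : (m * k = n * k -> m = n)%N.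
  by move/eqP; rewrite eqn_pmul2r // => /eqP.
move=> e3 e2i e2r e1.
have -> : n1 = (k.+1 + 1)%N by apply: cancel; rewrite e1; ring.
have -> : n3 = (k.+1 ^ 2 * k)%N by apply: cancel; rewrite e3; ring.
(* Both remaining numerators are exhibited as doubles, so the integer divisions by 2 are exact. *)
have -> : (3 * k.+1 ^ 2 + k.+1 = n2r * 2)%N.
  by apply: cancel; rewrite mulnAC e2r; ring.
have -> : (k.+1 * k = n2i * 2)%N by apply: cancel; rewrite mulnAC e2i; ring.
by rewrite !mulnK.
Qed.
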